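(* Let $E$ be a nonzero real Banach space and let $f\colon E\to\,]{-}\infty,\infty]$ be proper, convex and lower semicontinuous. Then the subdifferential $\partial f\colon E\rightrightarrows E^*$ is closed, monotone and quasidense.
   Context: $E^*$ is the dual of $E$ with pairing $\langle x,x^*\rangle$. The Fenchel conjugate is $f^*(x^* )=\sup_{x\in E}[\langle x,x^*\rangle-f(x)]$, and $x^*\in\partial f(x)$ iff $f(x)+f^*(x^* )=\langle x,x^*\rangle$. For a multifunction $S\colon E\rightrightarrows E^*$ with nonempty graph $G(S)\subset E\times E^*$: $S$ is closed if $G(S)$ is norm-closed in $E\times E^*$; monotone if $\langle s-t,s^*-t^*\rangle\ge0$ for all $(s,s^* ),(t,t^* )\in G(S)$; quasidense if for every $(x,x^* )\in E\times E^*$, $\inf_{(s,s^* )\in G(S)}\big[\tfrac12\|s-x\|^2+\tfrac12\|s^*-x^*\|^2+\langle s-x,s^*-x^*\rangle\big]\le 0$. *)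

(* Defs.v *)
From HB Require Import structures.
From mathcomp Require Import all_boot all_order all_algebra.
From mathcomp Require Import all_classical all_reals all_analysis.
Set Implicit Arguments. Unset Strict Implicit. Unset Printing Implicit Defensive.
Import Order.TTheory GRing.Theory Num.Theory.
Import numFieldNormedType.Exports.
Local Open Scope classical_set_scope.
Local Open Scope ring_scope.

Section Defs.
Variables (R : realType) (E : normedModType R).

Definition dual_space : set (E -> R) :=
  [set phi | (forall (a : R) (x y : E), phi (a *: x + y) = a * phi x + phi y)
             /\ continuous phi].

Definition dual_norm (phi : E -> R) : R :=
  sup ((fun x : E => `|phi x|) @` [set x : E | `|x| <= 1]).

Definition fenchel_conj (f : E -> \bar R) (phi : E -> R) : \bar R :=
  ereal_sup [set ((phi x)%:E - f x)%E | x in [set: E]].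

Definition proper_fun (f : E -> \bar R) : Prop :=
  (forall x, f x != -oo%E) /\ (exists x, (f x < +oo)%E).

Definition convex_fun (f : E -> \bar R) : Prop :=
  forall (x y : E) (t : R), 0 < t < 1 ->
    (f (t *: x + (1 - t) *: y)%R <= t%:E * f x + (1 - t)%:E * f y)%E.

Definition lsc_fun (f : E -> \bar R) : Prop :=
  forall (x : E) (a : R), (a%:E < f x)%E -> \forall y \near x, (a%:E < f y)%E.

Definition subdiff (f : E -> \bar R) (x : E) : set (E -> R) :=
  [set phi | dual_space phi /\ (f x + fenchel_conj f phi)%E = (phi x)%:E].

Definition graph (S : E -> set (E -> R)) : set (E * (E -> R)) :=
  [set p | S p.1 p.2].

Definition mf_closed (S : E -> set (E -> R)) : Prop :=
  forall (x : E) (xs : E -> R), dual_space xs ->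
    (forall e : R, 0 < e -> exists s ss, S s ss /\
        `|s - x| + dual_norm (ss \- xs) < e) ->
    S x xs.

Definition mf_monotone (S : E -> set (E -> R)) : Prop :=
  forall s ss t ts, S s ss -> S t ts -> 0 <= ss (s - t) - ts (s - t).

Definition mf_quasidense (S : E -> set (E -> R)) : Prop :=
  forall (x : E) (xs : E -> R), dual_space xs ->
    (ereal_inf [set ((2^-1 * `|p.1 - x| ^+ 2 + 2^-1 * dual_norm (p.2 \- xs) ^+ 2
                      + (p.2 (p.1 - x) - xs (p.1 - x)))%:E)
                | p in graph S] <= 0)%E.

End Defs.

(* Main.v *)
Require Import Defs.
From HB Require Import structures.
From mathcomp Require Import all_boot all_order all_algebra.
From mathcomp Require Import all_classical all_reals all_analysis.
From mathcomp Require Import ring lra.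
Set Implicit Arguments. Unset Strict Implicit. Unset Printing Implicit Defensive.
Import Order.TTheory GRing.Theory Num.Theory.
Import numFieldNormedType.Exports.
Local Open Scope classical_set_scope.
Local Open Scope ring_scope.

(** After translation, quasidensity asks, for a proper convex lsc [g] and
    [eta > 0], for [s] and [phi] in the subdifferential of [g] at [s] such that
    [|s|^2/2 + |phi|^2/2 + phi s <= eta]. Ekeland's variational principle,
    applied to [g + |.|^2/2] (which is coercive, as [g] decreases at most
    linearly), gives an [s] minimizing [g + |.|^2/2 + eps |. - s|]. Separating
    [g] from the other two terms by a Hahn-Banach sandwich yields a [phi] in
    the subdifferential of [g] at [s] with [- phi] a subgradient of
    [|.|^2/2 + eps |. - s|] at [s], whence
    [|s|^2/2 + |phi|^2/2 + phi s <= eps (|s| + |phi|)]; and [|s|], [|phi|] stay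
    bounded as [eps] tends to 0. *)

(** * Hahn-Banach: linear minorants of sublinear functions *)

Section HahnBanach.
Variables (R : realType) (E : lmodType R).

Definition linear_form (phi : E -> R) : Prop :=
  forall (a : R) x y, phi (a *: x + y) = a * phi x + phi y.

Definition sublinear (q : E -> R) : Prop :=
  (forall x y, q (x + y) <= q x + q y) /\
  (forall a x, 0 <= a -> q (a *: x) <= a * q x).

Lemma sublinear0 q : sublinear q -> q 0 = 0.
Proof.
move=> [qD qZ]; apply/eqP; rewrite eq_le; apply/andP; split.
  by have := qZ 0 0 (lexx _); rewrite scale0r mul0r.
by have := qD 0 0; rewrite addr0; lra.
Qed.

Lemma sublinearZ q a x : sublinear q -> 0 <= a -> q (a *: x) = a * q x.
Proof.
move=> sq a0; have [_ qZ] := sq; apply/eqP; rewrite eq_le qZ//=.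
have [->|an0] := eqVneq a 0; first by rewrite mul0r scale0r sublinear0.
have a_gt0 : 0 < a by rewrite lt0r an0.
rewrite -ler_pdivlMl//; apply: le_trans (qZ _ _ _); last by rewrite invr_ge0.
by rewrite scalerA mulVf// scale1r.
Qed.

Lemma sublinear_geN q x : sublinear q -> - q (- x) <= q x.
Proof.
move=> sq; have [qD _] := sq; have := qD x (- x).
by rewrite subrr sublinear0 //; lra.
Qed.

(** Subadditivity survives the infimum because, of two members of the chain, the smaller one can be
    used at both points. Each member is at least [- p (- x)] at [x], so the infima are genuine. *)
Lemma sublinear_inf_chain (p : E -> R) (A : set (E -> R)) :
  A !=set0 -> (forall q, A q -> sublinear q /\ forall x, q x <= p x) ->
  total_on A (fun q r => forall x, r x <= q x) ->
  sublinear (fun x => inf [set q x | q in A]) /\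
  forall q x, A q -> inf [set r x | r in A] <= q x.
Proof.
move=> [q0 Aq0] Asub Atot.
have lbA x : has_lbound [set q x | q in A].
  exists (- p (- x)) => _ [q Aq <-].
  have [sq qp] := Asub _ Aq.
  by apply: le_trans (sublinear_geN x sq); rewrite lerN2.
have neA x : [set q x | q in A] !=set0 by exists (q0 x), q0.
have infA q x : A q -> inf [set r x | r in A] <= q x.
  by move=> Aq; apply: ge_inf => //; exists q.
split=> //; split=> [x y|a x a0]; last first.
  have [->|an0] := eqVneq a 0.
    rewrite mul0r scale0r; apply: le_trans (infA _ _ Aq0) _.
    by rewrite sublinear0 //; case: (Asub _ Aq0).
  have a_gt0 : 0 < a by rewrite lt0r an0.
  rewrite -ler_pdivrMl//; apply: lb_le_inf => // _ [q Aq <-].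
  rewrite ler_pdivrMl//; apply: le_trans (infA _ _ Aq) _.
  by have [[_ qZ] _] := Asub _ Aq; exact: qZ.
rewrite -lerBlDr; apply: lb_le_inf => // _ [q Aq <-].
rewrite lerBlDr -lerBlDl; apply: lb_le_inf => // _ [r Ar <-].
rewrite lerBlDl.
have [qr|rq] := Atot _ _ Aq Ar.
  apply: le_trans (infA _ _ Ar) _; have [[rD _] _] := Asub _ Ar.
  by apply: le_trans (rD _ _) _; rewrite lerD2r.
apply: le_trans (infA _ _ Aq) _; have [[qD _] _] := Asub _ Aq.
by apply: le_trans (qD _ _) _; rewrite lerD2l.
Qed.

(** Zorn's lemma on the sublinear minorants of [p], ordered by reverse pointwise comparison. *)
Lemma minimal_sublinear (p : E -> R) : sublinear p ->
  exists2 q, sublinear q /\ (forall x, q x <= p x) &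
    forall r, sublinear r -> (forall x, r x <= q x) -> r = q.
Proof.
move=> sp.
pose T := {q : E -> R | sublinear q /\ forall x, q x <= p x}.
pose leT (s t : T) := `[< forall x, sval t x <= sval s x >].
have [|r s t /asboolP rs /asboolP st|s t /asboolP st /asboolP ts|A Atot|q qmax] :=
  @Zorn T leT.
- by move=> t; apply/asboolP.
- by apply/asboolP => x; exact: le_trans (st x) (rs x).
- case: s t st ts => [s sP] [t tP] /= st ts.
  have e : s = t by apply/funext => x; apply/eqP; rewrite eq_le st ts.
  by case: _ / e tP {st ts} => tP; rewrite (Prop_irrelevance sP tP).
(* The empty chain is bounded by [p] itself, since an infimum over it would be a default value. *)
- have [[t At]|] := pselect (A !=set0); last first.
    move=> A0; exists (exist _ p (conj sp (fun=> lexx _))) => s As.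
    by case: A0; exists s.
  have [|q [s _ <-]||sinf infle] :=
      @sublinear_inf_chain p [set sval s | s in A].
  + by exists (sval t), t.
  + exact: (svalP s).
  + move=> _ _ [s As <-] [r Ar <-].
    by case: (Atot _ _ As Ar) => /asboolP ?; [left|right].
  + unshelve eexists.
      exists (fun x => inf [set q x | q in [set sval s | s in A]]).
      split=> // x; apply: le_trans (infle _ x _) ((svalP t).2 x).
      by exists t.
    by move=> s As; apply/asboolP => x /=; apply: infle; exists s.
exists (sval q); first exact: (svalP q).
move=> r sr rq.
have rp x : r x <= p x by exact: le_trans (rq x) ((svalP q).2 x).
by rewrite -(qmax (exist _ r (conj sr rp))) //; apply/asboolP.
Qed.

(* For fixed [y], [x |-> inf_(t >= 0) q (x + t y) - t q y] is a sublinear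
   minorant of [q] which is at most [- q y] at [- y]. *)
Lemma minimal_sublinear_oppr (q : E -> R) : sublinear q ->
  (forall r, sublinear r -> (forall x, r x <= q x) -> r = q) ->
  forall y, q (- y) = - q y.
Proof.
move=> sq qmin y; have [qD qZ] := sq.
pose S x := [set q (x + t *: y) - t * q y | t in [set t : R | 0 <= t]].
have lbS x : has_lbound (S x).
  exists (- q (- x)) => _ [t /= t0 <-].
  have := qD (x + t *: y) (- x).
  by rewrite addrAC subrr add0r sublinearZ//; lra.
have neS x : S x !=set0 by exists (q (x + 0 *: y) - 0 * q y), 0 => /=.
have infS x t : 0 <= t -> inf (S x) <= q (x + t *: y) - t * q y.
  by move=> t0; apply: ge_inf => //; exists t.
have infq x : inf (S x) <= q x.
  by have := infS x 0 (lexx _); rewrite scale0r addr0 mul0r subr0.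
have sS : sublinear (fun x => inf (S x)).
  split=> [u v|a u a0].
    rewrite -lerBlDr; apply: lb_le_inf => // _ [s /= s0 <-].
    rewrite lerBlDr -lerBlDl; apply: lb_le_inf => // _ [t /= t0 <-].
    rewrite lerBlDl; apply: le_trans (infS _ _ (addr_ge0 s0 t0)) _.
    have := qD (u + s *: y) (v + t *: y).
    by rewrite addrACA -scalerDl; lra.
  have [->|an0] := eqVneq a 0.
    by rewrite mul0r scale0r; apply: le_trans (infq 0) _; rewrite sublinear0.
  have a_gt0 : 0 < a by rewrite lt0r an0.
  rewrite -ler_pdivrMl//; apply: lb_le_inf => // _ [t /= t0 <-].
  rewrite ler_pdivrMl//; apply: le_trans (infS _ _ (mulr_ge0 a0 t0)) _.
  by rewrite -scalerA -scalerDr sublinearZ//; lra.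
apply/eqP; rewrite eq_le; apply/andP; split; last first.
  by have := sublinear_geN (- y) sq; rewrite opprK.
have /(congr1 (fun r => r (- y))) <- := qmin _ sS infq.
apply: le_trans (infS _ _ ler01) _.
by rewrite scale1r addNr sublinear0// mul1r sub0r.
Qed.

(** A minimal sublinear minorant is odd, and for an odd function subadditivity at the opposite
    points yields the reverse inequality. *)
Lemma sublinear_dominated_linear (p : E -> R) : sublinear p ->
  exists2 phi : E -> R, linear_form phi &
    forall x, phi x <= p x.
Proof.
move=> /minimal_sublinear [q [sq qp] qmin]; exists q => //.
have qN := minimal_sublinear_oppr sq qmin.
have qD x y : q (x + y) = q x + q y.
  have [qD _] := sq; apply/eqP; rewrite eq_le qD /=.
  by have := qD (- x) (- y); rewrite -opprD !qN; lra.
move=> a x y; rewrite qD; congr (_ + _).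
have [a0|a0] := leP 0 a; first exact: sublinearZ.
apply: oppr_inj; rewrite -qN -scaleNr sublinearZ ?mulNr//.
by rewrite oppr_ge0 ltW.
Qed.
End HahnBanach.

(** * Sandwich theorem and subdifferential sum rule *)

Section SumRule.
Variables (R : realType) (E : normedModType R).
Implicit Types (g : E -> \bar R) (h phi : E -> R).

Definition convex_real h : Prop :=
  forall x y (t : R), 0 < t < 1 ->
    h (t *: x + (1 - t) *: y) <= t * h x + (1 - t) * h y.

(** Convexity read on the epigraph: real bounds stand in for values of [g] that may be infinite. *)
Lemma convex_fun_le g x y (a b t : R) : convex_fun g -> 0 < t < 1 ->
  (g x <= a%:E)%E -> (g y <= b%:E)%E ->
  (g (t *: x + (1 - t) *: y)%R <= (t * a + (1 - t) * b)%:E)%E.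
Proof.
move=> cg t01 ga gb; apply: le_trans (cg x y t t01) _.
have /andP[t0 t1] := t01.
by rewrite (EFinD (t * a)); apply: leeD; rewrite EFinM lee_pmul2l// lte_fin// subr_gt0.
Qed.

(** The infimum over [t > 0] and [w] of [t^-1 * (h (t *: v + w) + g w)] is sublinear in [v], at most
    [h v], and at most [g w] when [v = - w]. A linear [psi] below it gives [phi = - psi] between
    [- h] and [g]. *)
Lemma sandwich g h : convex_fun g -> convex_real h ->
  (g 0%R <= 0%:E)%E -> h 0 = 0 ->
  (forall x (b : R), (g x <= b%:E)%E -> 0 <= b + h x) ->
  exists2 phi, linear_form phi &
    forall x, - phi x <= h x /\ forall b : R, (g x <= b%:E)%E -> phi x <= b.
Proof.
move=> cg ch g0 h0 gh.
pose S v := [set r | exists t w b,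
  [/\ 0 < t, (g w <= b%:E)%E & r = t^-1 * (h (t *: v + w) + b)]].
have neS v : S v !=set0 by exists (1^-1 * (h (1 *: v + 0) + 0)), 1, 0, 0.
have lbS v : lbound (S v) (- h (- v)).
  move=> _ [t [w [b [t0 gw ->]]]].
  (* With weight [l], the points [t *: v + w] and [- v] combine to [l *: w], as do [w] and [0]: the
     convexity bounds for [h] and [g] meet at one point. *)
  pose l := (1 + t)^-1.
  have l0 : 0 < l by rewrite invr_gt0 addr_gt0.
  have lE : 1 - l = l * t by rewrite /l; field; rewrite gt_eqF// addr_gt0.
  have l01 : 0 < l < 1 by rewrite l0/= -subr_gt0 lE mulr_gt0.
  have := gh _ _ (convex_fun_le cg l01 gw g0).
  have := ch (t *: v + w) (- v) _ l01.
  rewrite scaler0 addr0 lE scalerDr scalerA scalerN addrAC subrr add0r => h1 h2.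
  have h3 : 0 <= l * (b + h (t *: v + w) + t * h (- v)) by lra.
  rewrite pmulr_rge0// in h3.
  by rewrite mulrC ler_pdivlMr//; lra.
have hlS v : has_lbound (S v) by exists (- h (- v)).
have infS v t w b : 0 < t -> (g w <= b%:E)%E ->
    inf (S v) <= t^-1 * (h (t *: v + w) + b).
  by move=> t0 gw; apply: ge_inf => //; exists t, w, b.
have infSh v : inf (S v) <= h v.
  have := infS v 1 0 0 ltr01 g0.
  by rewrite invr1 mul1r scale1r !addr0.
have infSg w b : (g w <= b%:E)%E -> inf (S (- w)) <= b.
  move=> gw; have := infS (- w) 1 w b ltr01 gw.
  by rewrite invr1 mul1r scale1r addNr h0 add0r.
have sS : sublinear (fun v => inf (S v)).
  split=> [u v|a u a0].
    rewrite -lerBlDr; apply: lb_le_inf => // _ [s [w [b [s0 gw ->]]]].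
    rewrite lerBlDr -lerBlDl; apply: lb_le_inf => // _ [t [z [c [t0 gz ->]]]].
    rewrite lerBlDl.
    have st0 : 0 < s + t by exact: addr_gt0.
    have stN0 : s + t != 0 by rewrite gt_eqF.
    have sN0 : s != 0 by rewrite gt_eqF.
    have tN0 : t != 0 by rewrite gt_eqF.
    (* Chosen so that [l * s] and [(1 - l) * t] both equal [s * t / (s + t)], whose inverse is
       [s^-1 + t^-1]. *)
    pose l := t / (s + t).
    have lE : 1 - l = s / (s + t) by rewrite /l; field.
    have l01 : 0 < l < 1.
      by rewrite -subr_gt0 lE !divr_gt0.
    have T0 : 0 < s * t / (s + t) by rewrite divr_gt0// mulr_gt0.
    apply: le_trans (infS _ _ _ _ T0 (convex_fun_le cg l01 gw gz)) _.
    have -> : (s * t / (s + t)) *: (u + v) + (l *: w + (1 - l) *: z) =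
              l *: (s *: u + w) + (1 - l) *: (t *: v + z).
      rewrite lE !scalerDr !scalerA addrACA; congr (_ *: _ + _ + (_ *: _ + _)).
        by rewrite /l; ring.
      by ring.
    rewrite ler_pdivrMl//.
    apply: le_trans (lerD (ch _ _ _ l01) (lexx _)) _.
    rewrite le_eqVlt; apply/orP; left; apply/eqP; rewrite lE /l.
    by move: (h _) (h _) => A B; field; rewrite tN0 sN0.
  have [->|an0] := eqVneq a 0.
    by rewrite mul0r scale0r; apply: le_trans (infSh 0) _; rewrite h0.
  have a_gt0 : 0 < a by rewrite lt0r an0.
  rewrite -ler_pdivrMl//; apply: lb_le_inf => // _ [t [w [b [t0 gw ->]]]].
  rewrite ler_pdivrMl//; apply: le_trans (infS _ _ _ _ (divr_gt0 t0 a_gt0) gw) _.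
  by rewrite scalerA divfK// invf_div mulrA.
have [psi psil psiS] := sublinear_dominated_linear sS.
have psiN x : psi (- x) = - psi x.
  have psi0 : psi 0 = 0.
    by have := psil 1 0 0; rewrite scale1r addr0; lra.
  by have := psil (-1) x 0; rewrite scaleN1r addr0 psi0 addr0 mulN1r.
exists (fun x => - psi x) => [a x y|x]; first by rewrite psil; lra.
split=> [|b gb]; first by rewrite opprK; exact: le_trans (psiS x) (infSh x).
by rewrite -psiN; apply: le_trans (psiS (- x)) (infSg _ _ gb).
Qed.

(** Serves twice: with [h] constant, to normalize [g] for [sandwich], and with [h] a linear form, to
    move a point of [E] times its dual to the origin. *)
Lemma convex_fun_shift g s h : convex_fun g ->
  (forall x y (t : R), 0 < t < 1 ->
    h (t *: x + (1 - t) *: y) = t * h x + (1 - t) * h y) ->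
  convex_fun (fun v => g (s + v)%R - (h v)%:E)%E.
Proof.
move=> cg ah x y t t01.
have -> : s + (t *: x + (1 - t) *: y) = t *: (s + x) + (1 - t) *: (s + y).
  by rewrite !scalerDr addrACA -scalerDl [t + _]addrC subrK scale1r.
have hE : (t%:E * - (h x)%:E + (1 - t)%:E * - (h y)%:E =
           - (h (t *: x + (1 - t) *: y)%R)%:E)%E.
  by rewrite ah// -!EFinN -!EFinM -(EFinD (t * - _)); congr _%:E; ring.
rewrite !muleDr ?fin_num_adde_defl// addeACA hE.
exact: leeD2r (cg _ _ _ t01).
Qed.

(** At a minimizer [s] of [g + h], both functions, translated by [s] and made to vanish at the
    origin, satisfy the hypotheses of [sandwich]. *)
Lemma subdifferential_sum g h s (a : R) : convex_fun g -> convex_real h ->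
  g s = a%:E -> (forall x (b : R), (g x <= b%:E)%E -> a + h s <= b + h x) ->
  exists2 phi, linear_form phi & forall x,
    h s - phi (x - s) <= h x /\
    forall b : R, (g x <= b%:E)%E -> a + phi (x - s) <= b.
Proof.
move=> cg ch gs gh.
have [|||||phi phil phiP] :=
  @sandwich (fun v => g (s + v)%R - a%:E)%E (fun v => h (s + v) - h s).
- by apply: convex_fun_shift => // x y t _; ring.
- move=> x y t t01.
  have -> : s + (t *: x + (1 - t) *: y) = t *: (s + x) + (1 - t) *: (s + y).
    by rewrite !scalerDr addrACA -scalerDl [t + _]addrC subrK scale1r.
  by have := ch (s + x) (s + y) t t01; lra.
- by rewrite addr0 gs subee.
- by rewrite addr0 subrr.
- move=> x b; rewrite leeBlDr// -EFinD => /gh; lra.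
exists phi => // x; have [p1 p2] := phiP (x - s).
have e : s + (x - s) = x by rewrite addrC subrK.
rewrite e in p1 p2; split; first by lra.
move=> b gb; have := p2 (b - a); rewrite leeBlDr// -EFinD subrK => /(_ gb); lra.
Qed.
End SumRule.

(** Provides a real margin above [a], even if [x] is [+oo], for the arguments by lower
    semicontinuity. *)
Lemma EFin_lt_dense (R : realType) (a : R) (x : \bar R) : (a%:E < x)%E ->
  exists2 c : R, a < c & (c%:E < x)%E.
Proof.
case: x => [r| |]//; rewrite ?lte_fin => ar.
  by exists ((a + r) / 2); rewrite ?lte_fin; lra.
by exists (a + 1); rewrite ?ltry//; lra.
Qed.

(** * The dual norm; closedness and monotonicity of the subdifferential *)

Section Dual.
Variables (R : realType) (E : normedModType R).
Implicit Types (phi psi : E -> R) (f : E -> \bar R).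

Lemma linear_form0 phi : linear_form phi -> phi 0 = 0.
Proof. by move=> l; have := l 1 0 0; rewrite scale1r addr0; lra. Qed.

Lemma linear_formZ phi a x : linear_form phi -> phi (a *: x) = a * phi x.
Proof. by move=> l; rewrite -[a *: x]addr0 l linear_form0// addr0. Qed.

Lemma linear_formD phi x y : linear_form phi -> phi (x + y) = phi x + phi y.
Proof. by move=> l; rewrite -[x]scale1r l mul1r scale1r. Qed.

Lemma linear_formN phi x : linear_form phi -> phi (- x) = - phi x.
Proof. by move=> l; rewrite -scaleN1r linear_formZ// mulN1r. Qed.

Lemma linear_formB phi x y : linear_form phi -> phi (x - y) = phi x - phi y.
Proof. by move=> l; rewrite linear_formD// linear_formN. Qed.

(** A one-sided bound on the unit ball is enough: homogeneity spreads it to every [v], and oddness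
    makes it two-sided. *)
Lemma linear_form_norm_le phi (K : R) : linear_form phi ->
  (forall v, `|v| <= 1 -> phi v <= K) -> forall v, `|phi v| <= K * `|v|.
Proof.
move=> l phiK.
have le v : phi v <= K * `|v|.
  have [->|v0] := eqVneq v 0; first by rewrite normr0 mulr0 linear_form0.
  have nv : 0 < `|v| by rewrite normr_gt0.
  have : phi (`|v|^-1 *: v) <= K.
    apply: phiK; rewrite normrZ normfV normr_id mulVf//; exact: lt0r_neq0.
  by rewrite linear_formZ// ler_pdivrMl// mulrC.
move=> v; rewrite ler_norml le andbT.
by have := le (- v); rewrite linear_formN// normrN; lra.
Qed.

Lemma linear_form_continuous phi (K : R) : linear_form phi ->
  (forall v, `|phi v| <= K * `|v|) -> continuous phi.
Proof.
move=> l phiK x; apply/cvgrPdist_lt => e e0; near=> y.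
rewrite -linear_formB//; apply: le_lt_trans (phiK _) _.
(* [K] may be zero or negative, so a positive constant replaces it before dividing. *)
have K1 : 0 < `|K| + 1 by apply: ltr_wpDl.
apply: (@le_lt_trans _ _ ((`|K| + 1) * `|x - y|)).
  by apply: ler_wpM2r => //; have := ler_norm K; lra.
rewrite -ltr_pdivlMl//; near: y.
by apply: cvgr_dist_lt; rewrite // mulr_gt0// invr_gt0.
Unshelve. all: by end_near. Qed.

Lemma dual_space_bounded phi : dual_space phi ->
  exists K : R, forall v, `|phi v| <= K * `|v|.
Proof.
move=> [l c]; have /cvgrPdist_lt/(_ 1 ltr01) := c 0.
rewrite linear_form0// => /nbhs_normP[d /= d0 dP].
(* Half the radius keeps the scaled closed unit ball inside the open ball of radius [d]. *)
exists (d / 2)^-1; apply: linear_form_norm_le => // v v1.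
have : `|phi ((d / 2) *: v)| < 1.
  rewrite -normrN -sub0r; apply: dP => /=.
  rewrite /ball_/= sub0r normrN normrZ gtr0_norm ?divr_gt0//.
  by have : d / 2 * `|v| <= d / 2 * 1 by [apply: ler_wpM2l => //; lra]; lra.
rewrite linear_formZ// => /(le_lt_trans (ler_norm _)) h.
by rewrite -[leRHS]mulr1 ler_pdivlMl ?divr_gt0//; exact: ltW.
Qed.

Lemma dual_space_dominated phi (K : R) : linear_form phi ->
  (forall v, `|v| <= 1 -> phi v <= K) -> dual_space phi.
Proof.
move=> l phiK; split=> //.
exact: linear_form_continuous l (linear_form_norm_le l phiK).
Qed.

Lemma dual_spaceD phi psi :
  dual_space phi -> dual_space psi -> dual_space (phi \+ psi).
Proof.
move=> [l1 c1] [l2 c2]; split=> [a x y /=|x]; first by rewrite l1 l2; ring.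
by apply: cvgD; [exact: c1|exact: c2].
Qed.

Lemma dual_spaceB phi psi :
  dual_space phi -> dual_space psi -> dual_space (phi \- psi).
Proof.
move=> [l1 c1] [l2 c2]; split=> [a x y /=|x]; first by rewrite l1 l2; ring.
by apply: cvgB; [exact: c1|exact: c2].
Qed.

Lemma dual_norm_le phi (c : R) :
  (forall v, `|v| <= 1 -> `|phi v| <= c) -> dual_norm phi <= c.
Proof.
move=> phic; apply: ge_sup => [|_ [v v1 <-]]; last exact: phic.
by exists `|phi 0|, 0 => //=; rewrite normr0.
Qed.

(** Continuity makes [phi] bounded on the unit ball, so the [sup] in [dual_norm] is not a default
    value. *)
Lemma dual_norm_ub phi v : dual_space phi -> `|v| <= 1 ->
  `|phi v| <= dual_norm phi.
Proof.
move=> /dual_space_bounded[K phiK] v1; apply: ub_le_sup; last by exists v.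
exists `|K| => _ [w /= w1 <-]; apply: le_trans (phiK w) _.
apply: le_trans (ler_norm _) _; rewrite normrM normr_id.
by rewrite -[leRHS]mulr1; apply: ler_wpM2l.
Qed.

Lemma dual_norm_ge0 phi : dual_space phi -> 0 <= dual_norm phi.
Proof.
move=> d; apply: le_trans (dual_norm_ub (v := 0) d _) => //.
by rewrite normr0.
Qed.

Lemma dual_normP phi v : dual_space phi -> `|phi v| <= dual_norm phi * `|v|.
Proof.
move=> d; apply: linear_form_norm_le => [|w w1]; first by case: d.
exact: le_trans (ler_norm _) (dual_norm_ub d w1).
Qed.

(** The sum of [f x] and the conjugate is real only if both terms are; the equality then says that
    the supremum in the conjugate is attained at [x], which is the subgradient inequality. *)
Lemma subdiffP f x phi : (forall y, f y != -oo%E) ->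
  subdiff f x phi <-> dual_space phi /\ exists2 a : R, f x = a%:E &
    forall y (b : R), (f y <= b%:E)%E -> a + phi (y - x) <= b.
Proof.
move=> fNy; split=> [[d]|[d [a fx fP]]].
  move=> e; split=> //; have {}l := d.1.
  move: e; case fx : (f x) => [a| |]; case fc: fenchel_conj => [c| |]//.
  move=> [ac]; exists a => // y b fb.
  have : (((phi y)%:E - f y) <= c%:E)%E.
    by rewrite -fc; apply: ereal_sup_ubound; exists y.
  have : ((phi y)%:E - b%:E <= (phi y)%:E - f y)%E by apply: leeB.
  move=> /le_trans /[apply]; rewrite -EFinB lee_fin linear_formB//; lra.
split=> //; have l := d.1.
suff -> : fenchel_conj f phi = (phi x - a)%:E.
  by rewrite fx -EFinD; congr _%:E; ring.
apply/eqP; rewrite eq_le; apply/andP; split; last first.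
  by apply: ereal_sup_ubound; exists x => //; rewrite fx.
apply: ge_ereal_sup => _ [y _ <-].
have := fP y; have := fNy y; case: (f y) => [b _ /(_ b (lexx _))||]//.
  by rewrite -EFinB lee_fin linear_formB//; lra.
by move=> _ _; rewrite leNye.
Qed.

(** Add the subgradient inequalities at [s] and [t], each tested at the other point. *)
Lemma subdiff_monotone f : (forall y, f y != -oo%E) -> mf_monotone (subdiff f).
Proof.
move=> fNy s ss t ts /(subdiffP _ _ fNy)[[l1 _] [a fs sP]].
move=> /(subdiffP _ _ fNy)[[l2 _] [b ft tP]].
have := sP t b; have := tP s a; rewrite fs ft => /(_ (lexx _)) + /(_ (lexx _)).
by rewrite !linear_formB//; lra.
Qed.

(** If the subgradient inequality failed at [x], lower semicontinuity would make it fail at the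
    nearby pairs [(s, ss)] of the graph. *)
Lemma subdiff_closed f : proper_fun f -> lsc_fun f -> mf_closed (subdiff f).
Proof.
move=> [fNy [y0 fy0]] fl x xs dxs cl; apply/subdiffP => //; split=> //.
have le y (b : R) : (f y <= b%:E)%E -> (f x <= (b - xs (y - x))%:E)%E.
  move=> fb; apply: contrapT => /negP.
  rewrite -ltNge => /EFin_lt_dense[c bc cfx].
  have /nbhs_normP[d /= d0 dP] := fl x c cfx.
  pose eta := c - (b - xs (y - x)).
  have eta0 : 0 < eta by rewrite subr_gt0.
  (* [M] adds the coefficients of [e] in the three errors separating [ss (y - s)] from [xs (y - x)];
     [e <= 1] handles the product of two small factors. *)
  pose M := `|y - x| + 1 + dual_norm xs.
  have M0 : 0 < M.
    by rewrite /M; have := normr_ge0 (y - x); have := dual_norm_ge0 dxs; lra.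
  pose e := Num.min d (Num.min 1 (eta / M)).
  have e0 : 0 < e by rewrite !lt_min d0 ltr01 divr_gt0.
  have [s [ss [/(subdiffP _ _ fNy)[dss [a fs sP]] sse]]] := cl e e0.
  have dd : dual_space (ss \- xs) by exact: dual_spaceB.
  have n0 := dual_norm_ge0 dd.
  have m0 := normr_ge0 (s - x).
  have [ed e1 eM] : [/\ e <= d, e <= 1 & e * M <= eta].
    by rewrite -ler_pdivlMr// /e !ge_min !lexx !orbT.
  have ca : c < a.
    rewrite -lte_fin -fs; apply: dP; rewrite /ball_/= distrC; lra.
  have ab := sP y b fb.
  have h1 : `|ss (y - x) - xs (y - x)| <= dual_norm (ss \- xs) * `|y - x|.
    exact: (dual_normP (y - x) dd).
  have h2 : `|ss (s - x) - xs (s - x)| <= dual_norm (ss \- xs) * `|s - x|.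
    exact: (dual_normP (s - x) dd).
  have h3 := dual_normP (s - x) dxs.
  have e1' : y - s = (y - x) - (s - x) by rewrite opprB addrA subrK.
  rewrite e1' (linear_formB _ _ dss.1) in ab.
  have h4 : dual_norm (ss \- xs) * `|y - x| <= e * `|y - x|.
    by apply: ler_wpM2r => //; lra.
  have h5 : dual_norm (ss \- xs) * `|s - x| <= e * 1 by apply: ler_pM => //; lra.
  have h6 : dual_norm xs * `|s - x| <= dual_norm xs * e.
    by apply: ler_wpM2l; [exact: dual_norm_ge0|lra].
  move: h1 h2 h3 eM; rewrite !ler_norml /M /eta; lra.
(* Applied at a point where [f] is finite, [le] excludes [f x = +oo]. *)
have [b0 fb0] : exists b0 : R, (f y0 <= b0%:E)%E.
  move: (fNy y0) fy0; case: (f y0) => [r _ _||]//; by exists r.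
have := fNy x; have := le y0 b0 fb0; case fx : (f x) => [a| |]// _ _.
by exists a => // y b /le; rewrite fx lee_fin; lra.
Qed.

End Dual.

(** * Linear lower bounds and sums of lower semicontinuous functions *)

Section LowerSemicontinuous.
Variables (R : realType) (E : normedModType R).
Implicit Types f : E -> \bar R.

Lemma proper_fun_ltpinfty f : proper_fun f -> exists x (a : R), f x = a%:E.
Proof.
move=> [fNy [x fx]]; have := fNy x; have := fx.
by case fxE : (f x) => [a| |]// _ _; exists x, a.
Qed.

(** [f] exceeds [a - 1] on a ball around a point [x] where it equals [a]. By convexity, too steep a
    descent towards a far [y] would already break this on the segment from [x] to [y]. *)
Lemma convex_lsc_lower_bound f : proper_fun f -> convex_fun f -> lsc_fun f ->
  exists2 C : R, 0 <= C &
    forall y (b : R), (f y <= b%:E)%E -> - C * (1 + `|y|) <= b.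
Proof.
move=> pf cf lf; have [x [a fx]] := proper_fun_ltpinfty pf.
have /nbhs_normP[d /= d0 dP] : \forall y \near x, ((a - 1)%:E < f y)%E.
  by apply: lf; rewrite fx lte_fin; lra.
have zE y (t : R) : x - (t *: y + (1 - t) *: x) = - (t *: (y - x)).
  rewrite -scalerN opprB scalerBr scalerBl scale1r opprD opprB addrCA.
  by rewrite [x + _]addrCA subrr addr0 addrC.
have le y (b : R) : (f y <= b%:E)%E -> a - 1 - 2 / d * `|y - x| <= b.
  move=> fb; have [yd|dy] := ltP `|y - x| d.
    have /lt_le_trans/(_ fb) : ((a - 1)%:E < f y)%E.
      by apply: dP; rewrite /ball_/= distrC.
    have : 0 <= 2 / d * `|y - x| by rewrite mulr_ge0// divr_ge0// ltW.
    by rewrite lte_fin; lra.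
  have y0 : 0 < `|y - x| by exact: lt_le_trans dy.
  (* Puts the intermediate point at distance [d / 2] from [x]; a drop of at most 1 there gives the
     slope [2 / d]. *)
  pose t := d / 2 / `|y - x|.
  have t0 : 0 < t by rewrite !divr_gt0.
  have tE : t * `|y - x| = d / 2 by rewrite divfK// gt_eqF.
  have t1 : t < 1 by rewrite /t ltr_pdivrMr//; lra.
  have t01 : 0 < t < 1 by rewrite t0.
  have fx' : (f x <= a%:E)%E by rewrite fx.
  have fz : ((a - 1)%:E < f (t *: y + (1 - t) *: x)%R)%E.
    apply: dP; rewrite /ball_/=.
    rewrite zE.
    by rewrite normrN normrZ gtr0_norm// tE; lra.
  have := lt_le_trans fz (convex_fun_le cf t01 fb fx').
  rewrite lte_fin => h; rewrite leNgt; apply/negP => hb.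
  have : t * b < t * (a - 1 - 2 / d * `|y - x|) by rewrite ltr_pM2l.
  have -> : t * (a - 1 - 2 / d * `|y - x|) = t * (a - 1) - 2 / d * (t * `|y - x|).
    by ring.
  rewrite tE; have -> : 2 / d * (d / 2) = 1 by field; rewrite gt_eqF.
  by lra.
exists (`|a| + 1 + 2 / d * (1 + `|x|)) => [|y b /le].
  by rewrite !addr_ge0// mulr_ge0// ?divr_ge0 ?addr_ge0// ltW.
apply: le_trans.
have d2 : 0 <= 2 / d by rewrite divr_ge0// ltW.
have n1 : `|y - x| <= (1 + `|x|) * (1 + `|y|).
  apply: le_trans (ler_normB _ _) _.
  by have := mulr_ge0 (normr_ge0 x) (normr_ge0 y); lra.
have n2 := ler_wpM2l d2 n1.
have n3 : 0 <= (`|a| + 1) * `|y| by rewrite mulr_ge0// addr_ge0.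
have n4 : - `|a| <= a by rewrite lerNl -normrN ler_norm.
by lra.
Qed.

Lemma lsc_funD f (h : E -> R) : lsc_fun f -> continuous h ->
  lsc_fun (fun y => f y + (h y)%:E)%E.
Proof.
move=> lf ch x a; rewrite -lteBlDr// -EFinB => /EFin_lt_dense[c ac cf].
have e0 : 0 < c - (a - h x) by rewrite subr_gt0.
have /cvgrPdist_lt/(_ _ e0) hx := ch x.
near=> y.
rewrite -lteBlDr// -EFinB; apply: (@lt_trans _ _ c%:E); last first.
  by near: y; exact: lf.
rewrite lte_fin.
have : `|h x - h y| < c - (a - h x) by near: y.
by rewrite ltr_norml; lra.
Unshelve. all: by end_near. Qed.

End LowerSemicontinuous.

(** * Ekeland's variational principle *)

Section Ekeland.
Variables (R : realType) (E : completeNormedModType R).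
Variables (F : E -> \bar R) (m eps : R).
Hypotheses (lF : lsc_fun F) (Fm : forall y, (m%:E <= F y)%E) (eps0 : 0 < eps).

(** [fine] sends [+oo] to [0], so [u] is used only where [F] is known to be finite, for instance on
    the sets [S x]. *)
Let u x := fine (F x).
(** Ekeland's order: a move away from [x] must lower [F] by at least [eps] times its length. *)
Let S x := [set y | (F y <= (u x - eps * `|y - x|)%:E)%E].

Let fin x (b : R) : (F x <= b%:E)%E -> F x = (u x)%:E.
Proof.
by move: (Fm x); rewrite /u; case: (F x).
Qed.

Let Su x y : S x y -> u y <= u x - eps * `|y - x|.
Proof. by rewrite /S/= => h; move: (h); rewrite (fin h) lee_fin. Qed.

Let Sfin x y : S x y -> F y = (u y)%:E.
Proof. exact: fin. Qed.

Let Strans x y z : S x y -> S y z -> S x z.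
Proof.
move=> xy yz; have h1 := Su xy; have h2 := Su yz.
rewrite /S/= (Sfin yz) lee_fin.
have h3 : eps * `|z - x| <= eps * (`|z - y| + `|y - x|).
  by rewrite ler_pM2l//; have := ler_normD (z - y) (y - x); rewrite addrA subrK.
by lra.
Qed.

Let Srefl x : F x = (u x)%:E -> S x x.
Proof. by move=> Fx; rewrite /S/= subrr normr0 mulr0 subr0 -Fx. Qed.

Let Sclosed x (X : nat -> E) s : (X @ \oo --> s) ->
  (\forall n \near \oo, S x (X n)) -> S x s.
Proof.
move=> Xs SX; rewrite /S/=; apply: contrapT => /negP; rewrite -ltNge.
move=> /EFin_lt_dense[c hc cF].
have e0 : 0 < (c - (u x - eps * `|s - x|)) / eps by rewrite divr_gt0// subr_gt0.
have near1 : \forall n \near \oo, (c%:E < F (X n))%E by exact: Xs _ (lF cF).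
have /cvgrPdist_lt/(_ _ e0) near2 := Xs.
near \oo => n.
have h1 : `|s - X n| < (c - (u x - eps * `|s - x|)) / eps by near: n.
have h2 : (c%:E < F (X n))%E by near: n.
have h3 : S x (X n) by near: n.
have := Su h3; move: h2; rewrite (Sfin h3) lte_fin.
move: h1; rewrite ltr_pdivlMr// mulrC.
have h4 : eps * `|s - x| <= eps * (`|s - X n| + `|X n - x|).
  by rewrite ler_pM2l//; have := ler_normD (s - X n) (X n - x); rewrite addrA subrK.
by lra.
Unshelve. all: by end_near. Qed.

(** Selects near minimizers of [u] on [S x]. The step index is paired with the point so that a
    single choice function drives the whole iteration. *)
Let next : {nx : nat * E -> E | forall p, F p.2 = (u p.2)%:E ->
  S p.2 (nx p) /\ forall z, S p.2 z -> u (nx p) <= u z + p.1.+1%:R^-1}.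
Proof.
suff /choice[nx nxP] : forall p : nat * E, exists y, F p.2 = (u p.2)%:E ->
    S p.2 y /\ forall z, S p.2 z -> u y <= u z + p.1.+1%:R^-1.
  by exists nx.
move=> [n x] /=; have [Fx|] := pselect (F x = (u x)%:E); last by exists x.
have lb : has_lbound [set u z | z in S x].
  by exists m => _ [z Sz <-]; rewrite -lee_fin -(Sfin Sz).
have hi : has_inf [set u z | z in S x].
  by split=> //; exists (u x), x => //; exact: Srefl.
have n0 : (0 : R) < n.+1%:R^-1 by rewrite invr_gt0.
have [_ [y Sy <-] yi] := inf_adherent n0 hi.
exists y => _; split=> // z Sz; apply: le_trans (ltW yi) _.
by rewrite lerD2r; apply: ge_inf => //; exists z.
Qed.

(** The sets [S (X n)] are nested with diameters tending to 0, so [X] converges to a point [s] of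
    all of them. A point of [S s] lies in all of them too, hence is [s]. *)
Lemma ekeland x0 (a0 : R) : (F x0 <= a0%:E)%E ->
  exists s (a : R), [/\ F s = a%:E, a <= a0 &
    forall y (b : R), (F y <= b%:E)%E -> a <= b + eps * `|y - s|].
Proof.
move=> Fx0; have [nx nxP] := next.
pose X := nat_rect (fun=> E) x0 (fun n x => nx (n, x)).
have FX n : F (X n) = (u (X n))%:E.
  elim: n => [|n IH]; first exact: fin Fx0.
  by have [/Sfin] := nxP (n, X n) IH.
have SX n k : S (X n) (X (k + n)%N).
  elim: k => [|k IH]; first exact: Srefl.
  by apply: Strans IH _; have [] := nxP ((k + n)%N, X (k + n)%N) (FX _).
(* Such a [z] also lies in [S (X n)], where [X n.+1] nearly minimizes [u], so little descent is
   left. *)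
have Xsmall n z : S (X n.+1) z -> eps * `|z - X n.+1| <= n.+1%:R^-1.
  move=> Sz; have [SXn SXnz] := nxP (n, X n) (FX n).
  have h : u (X n.+1) <= u z + n.+1%:R^-1 := SXnz z (Strans SXn Sz).
  by move: h (Su Sz); move: n.+1%:R^-1 => q; lra.
have arch (e : R) : 0 < e -> exists n, (n.+1%:R^-1 : R) < e.
  by move=> /ltr_add_invr[n]; rewrite add0r; exists n.
have cX : cvg (X @ \oo).
  apply/cauchy_cvgP/cauchy_exP => e e0.
  have [n ne] := arch (eps * e) (mulr_gt0 eps0 e0).
  exists (X n.+1); exists n.+1 => // k /= nk.
  rewrite -ball_normE /ball_ /= distrC -(ltr_pM2l eps0).
  by apply: le_lt_trans ne; apply: Xsmall; rewrite -(subnK nk).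
pose s := lim (X @ \oo).
have Ss n : S (X n) s.
  apply: (Sclosed cX); exists n => // k /= nk.
  by rewrite -(subnK nk).
have Fs := Sfin (Ss 0%N).
exists s, (u s); split=> //.
  have h1 := Su (Ss 0%N); rewrite /= in h1.
  have h2 : 0 <= eps * `|s - x0| by rewrite mulr_ge0// ltW.
  by move: Fx0; rewrite (FX 0%N) lee_fin /=; lra.
move=> y b Fy; rewrite leNgt; apply/negP => bs.
have Sy : S s y by apply: le_trans Fy _; rewrite lee_fin; lra.
have ys : 0 < eps * `|y - s|.
  rewrite mulr_gt0// normr_gt0 subr_eq0; apply/eqP => ys.
  by move: Fy bs; rewrite ys Fs lee_fin subrr normr0; lra.
(* Both [y] and [s] are close to [X n.+1]; halving makes the two distances add up to less than that
   from [y] to [s]. *)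
have [n nlt] := arch (eps * `|y - s| / 2) (divr_gt0 ys (ltr0Sn _ 1)).
have h1 := Xsmall n y (Strans (Ss n.+1) Sy).
have h2 := Xsmall n s (Ss n.+1).
have h3 : eps * `|y - s| <= eps * (`|y - X n.+1| + `|s - X n.+1|).
  rewrite ler_pM2l// [X in _ <= _ + X]distrC.
  by have := ler_normD (y - X n.+1) (X n.+1 - s); rewrite addrA subrK.
by move: nlt h1 h2 h3; move: n.+1%:R^-1 => q; lra.
Qed.

End Ekeland.

(** * Convexity and subgradients of the perturbed half squared norm *)

Section Perturbation.
Variables (R : realType) (E : normedModType R).

Lemma continuous_half_sqr_norm : continuous (fun y : E => 2^-1 * `|y| ^+ 2).
Proof.
move=> x; apply: cvgMr; rewrite /= expr2; under eq_fun do rewrite expr2.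
by apply: cvgM; apply: cvg_norm; exact: cvg_id.
Qed.

Lemma convex_half_sqr_normD (eps : R) (s : E) : 0 <= eps ->
  convex_real (fun y : E => 2^-1 * `|y| ^+ 2 + eps * `|y - s|).
Proof.
move=> eps0 x y t /andP[t0 t1].
have n1 : `|t *: x + (1 - t) *: y| <= t * `|x| + (1 - t) * `|y|.
  apply: le_trans (ler_normD _ _) _.
  by rewrite !normrZ !gtr0_norm// subr_gt0.
have -> : t *: x + (1 - t) *: y - s = t *: (x - s) + (1 - t) *: (y - s).
  rewrite !scalerBr [in RHS]addrACA -opprD -[in RHS]scalerDl.
  by rewrite [t + _]addrC subrK scale1r.
have n2 : `|t *: (x - s) + (1 - t) *: (y - s)| <=
          t * `|x - s| + (1 - t) * `|y - s|.
  apply: le_trans (ler_normD _ _) _.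
  by rewrite !normrZ !gtr0_norm// subr_gt0.
have n3 := ler_wpM2l eps0 n2.
have n4 : `|t *: x + (1 - t) *: y| ^+ 2 <= (t * `|x| + (1 - t) * `|y|) ^+ 2.
  by rewrite lerXn2r// nnegrE ?addr_ge0// mulr_ge0// ?subr_ge0 ltW.
(* This is exactly the convexity gap of the square between [|x|] and [|y|]. *)
have n5 : 0 <= t * (1 - t) * (`|x| - `|y|) ^+ 2.
  by rewrite mulr_ge0 ?sqr_ge0// mulr_ge0// ?subr_ge0 ltW.
have -> : t * (2^-1 * `|x| ^+ 2 + eps * `|x - s|) +
    (1 - t) * (2^-1 * `|y| ^+ 2 + eps * `|y - s|) =
  2^-1 * ((t * `|x| + (1 - t) * `|y|) ^+ 2 +
          t * (1 - t) * (`|x| - `|y|) ^+ 2) +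
  eps * (t * `|x - s| + (1 - t) * `|y - s|) by field.
by lra.
Qed.

(* Testing the hypothesis at [y = - N v], where [N] is the dual norm of [phi]
   and [v] ranges over the unit ball, bounds [N ^+ 2]. *)
Lemma half_sqr_norm_subgradient (eps : R) (s : E) (phi : E -> R) : 0 <= eps ->
  linear_form phi ->
  (forall y, 2^-1 * `|s| ^+ 2 - phi (y - s) <= 2^-1 * `|y| ^+ 2 + eps * `|y - s|) ->
  dual_space phi /\
  2^-1 * `|s| ^+ 2 + 2^-1 * dual_norm phi ^+ 2 + phi s <=
    eps * (`|s| + dual_norm phi).
Proof.
move=> eps0 l phiP.
have d : dual_space phi.
  (* The bound comes from testing the hypothesis at [s - v]. *)
  apply: (@dual_space_dominated _ _ _ (2^-1 * (`|s| + 1) ^+ 2 + eps)) => // v v1.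
  have svs : s - v - s = - v by rewrite addrAC subrr sub0r.
  have := phiP (s - v); rewrite svs (linear_formN _ l) normrN.
  have n1 : `|s - v| ^+ 2 <= (`|s| + 1) ^+ 2.
    rewrite lerXn2r ?nnegrE ?addr_ge0//; apply: le_trans (ler_normB _ _) _.
    by rewrite lerD2l.
  have n2 : eps * `|v| <= eps * 1 by rewrite ler_wpM2l.
  by have := sqr_ge0 `|s|; lra.
split=> //; have N0 := dual_norm_ge0 d; set N := dual_norm phi in N0 *.
pose K := 2^-1 * N ^+ 2 + eps * (N + `|s|) - 2^-1 * `|s| ^+ 2 - phi s.
have phiK v : `|v| <= 1 -> N * phi v <= K.
  move=> v1; have := phiP (- (N *: v)).
  rewrite normrN normrZ (ger0_norm N0) (linear_formB _ _ l) (linear_formN _ l).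
  rewrite (linear_formZ _ _ l).
  have n1 : N * `|v| <= N by rewrite -[leRHS]mulr1 ler_wpM2l.
  have n2 : (N * `|v|) ^+ 2 <= N ^+ 2 by rewrite lerXn2r ?nnegrE ?mulr_ge0.
  have n3 : eps * `|- (N *: v) - s| <= eps * (N + `|s|).
    rewrite ler_wpM2l//; apply: le_trans (ler_normB _ _) _.
    by rewrite lerD2r normrN normrZ (ger0_norm N0).
  by rewrite /K; lra.
suff : N ^+ 2 <= K by rewrite /K; lra.
(* Passing to the supremum over [v] divides by [N]; if [N = 0], the test at [v = 0] already gives
   [0 <= K]. *)
have [N_eq0|N_neq0] := eqVneq N 0.
  have := phiK 0; rewrite normr0 N_eq0 mul0r expr0n/= => -> //.
have Ngt0 : 0 < N by rewrite lt0r N_neq0.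
rewrite expr2 -ler_pdivlMl//; apply: dual_norm_le => v v1.
rewrite ler_pdivlMl// -(ger0_norm N0) -normrM ler_norml phiK// andbT.
by have := phiK (- v); rewrite normrN (linear_formN _ l) => /(_ v1); lra.
Qed.

End Perturbation.

(** * Quasidensity at the origin *)

Section ApproximateMinimum.
Variables (R : realType) (E : completeNormedModType R).

Lemma subdiff_approx_antipodal (g : E -> \bar R) (eta : R) :
  proper_fun g -> convex_fun g -> lsc_fun g -> 0 < eta ->
  exists s phi, subdiff g s phi /\
    2^-1 * `|s| ^+ 2 + 2^-1 * dual_norm phi ^+ 2 + phi s <= eta.
Proof.
move=> pg cg lg eta0; have gNy := pg.1.
have [C C0 gC] := convex_lsc_lower_bound pg cg lg.
have [x0 [b0 gx0]] := proper_fun_ltpinfty pg.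
pose F y := (g y + (2^-1 * `|y| ^+ 2)%:E)%E.
have FP y (b : R) : (F y <= b%:E)%E = (g y <= (b - 2^-1 * `|y| ^+ 2)%:E)%E.
  by rewrite /F -leeBrDr// -EFinB.
have lF : lsc_fun F := lsc_funD lg (@continuous_half_sqr_norm R E).
(* The minimum of [- C * (1 + t) + t^2 / 2] over real [t], reached at [t = C]. *)
have Fm y : ((- C - 2^-1 * C ^+ 2)%:E <= F y)%E.
  rewrite /F; have := gNy y; have := gC y; case: (g y) => [b /(_ b (lexx _))||]//.
    by rewrite lee_fin => h _; have := sqr_ge0 (`|y| - C); nra.
  by move=> _ _; rewrite leey.
pose a0 := b0 + 2^-1 * `|x0| ^+ 2.
have Fx0 : (F x0 <= a0%:E)%E by rewrite FP gx0 lee_fin /a0; lra.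
(* [r] bounds the norm on the sublevel set of [F] at [a0], whatever [eps] is. The dual norm will be
   at most [3 * r + 3], whence the denominator [4 * r + 3] in [eps]. *)
pose r := 2 * C + 2 + 2 * `|a0|.
have a00 := normr_ge0 a0.
have r0 : 0 < 4 * r + 3 by rewrite /r; lra.
pose eps := Num.min 1 (eta / (4 * r + 3)).
have eps0 : 0 < eps by rewrite lt_min ltr01 divr_gt0.
have eps1 : eps <= 1 by rewrite ge_min lexx.
have epsr : eps * (4 * r + 3) <= eta.
  by rewrite -ler_pdivlMr// /eps ge_min lexx orbT.
have [s [a [Fs aa0 sP]]] := ekeland lF Fm eps0 Fx0.
have gs : g s = (a - 2^-1 * `|s| ^+ 2)%:E.
  by move: Fs; rewrite /F; case: (g s) => [b [<-]||]//; congr _%:E; ring.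
have sr : `|s| <= r.
  have := gC s (a - 2^-1 * `|s| ^+ 2); rewrite gs lexx => /(_ isT) h.
  rewrite leNgt; apply/negP => rs.
  have h1 : r * `|s| <= `|s| ^+ 2 by rewrite expr2 ler_wpM2r// ltW.
  have h2 : 0 <= `|a0| * `|s| by rewrite mulr_ge0.
  have h3 := ler_norm a0.
  by move: h1 rs; rewrite /r; lra.
have [|phi l phiP] := subdifferential_sum cg
    (convex_half_sqr_normD s (ltW eps0)) gs.
  move=> y b /= gb; have := sP y (b + 2^-1 * `|y| ^+ 2); rewrite FP addrK => /(_ gb).
  by rewrite subrr normr0; lra.
have [|d main] := half_sqr_norm_subgradient (ltW eps0) l (s := s).
  by move=> y; have [+ _] := phiP y; rewrite subrr normr0; lra.
exists s, phi; split.
  apply/subdiffP => //; split=> //; exists (a - 2^-1 * `|s| ^+ 2) => // y b.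
  by have [_] := phiP y; apply.
have N0 := dual_norm_ge0 d; have := dual_normP s d; move: main.
set N := dual_norm phi in N0 * => main.
rewrite ler_norml => /andP[h2 _].
apply: (le_trans main); apply: le_trans epsr; rewrite ler_wpM2l//; first exact: ltW.
have s0 := normr_ge0 s.
suff : N <= 3 * r + 3 by lra.
have h1 : eps * (`|s| + N) <= `|s| + N.
  by rewrite -[leRHS]mul1r ler_wpM2r// addr_ge0.
have r2 : 2 <= r by rewrite /r; lra.
(* As [phi s] is at least [- N * |s|], the estimate gives [(N - |s|)^2 / 2 <= N + |s|]. If
   [N > 3 * r + 3], then [N - |s| > 7], so [5 * N <= 9 * |s|], which contradicts [|s| <= r]. *)
rewrite leNgt; apply/negP => Nr.
have h3 : 0 <= (N - `|s|) * (N - `|s| - 7).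
  by apply: mulr_ge0; lra.
by lra.
Qed.

End ApproximateMinimum.

(** * Reduction of quasidensity to the origin *)

Theorem theorem2p14 (R : realType) (E : completeNormedModType R)
  (f : E -> \bar R) :
  (exists x : E, x != 0) ->
  proper_fun f -> convex_fun f -> lsc_fun f ->
  mf_closed (subdiff f) /\ mf_monotone (subdiff f) /\ mf_quasidense (subdiff f).
Proof.
move=> _ pf cf lf; have fNy := pf.1.
split; first exact: subdiff_closed.
split; first exact: subdiff_monotone.
move=> x xs dxs.
(* This moves [(x, xs)] to the origin: a subgradient [phi] of [g] at [s] corresponds to the
   subgradient [phi \+ xs] of [f] at [x + s]. *)
pose g v := (f (x + v)%R - (xs v)%:E)%E.
have [y0 [b0 fy0]] := proper_fun_ltpinfty pf.
have pg : proper_fun g.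
  split=> [v|]; first by rewrite /g; have := fNy (x + v); case: (f _).
  by exists (y0 - x); rewrite /g [x + _]addrC subrK fy0 -EFinB ltry.
have cg : convex_fun g.
  apply: convex_fun_shift => // u v t _.
  by rewrite (linear_formD _ _ dxs.1) !(linear_formZ _ _ dxs.1).
have lg : lsc_fun g.
  apply: (@lsc_funD _ _ (fun v => f (x + v)) (fun v => - xs v)).
    move=> v a /lf; apply: (@cvgD _ _ _ _ _ (cst x) id); first exact: cvg_cst.
    exact: cvg_id.
  by move=> v; apply: cvgN; exact: dxs.2.
apply/lee_addgt0Pr => eta eta0; rewrite add0e.
have [s [phi [/(subdiffP _ _ pg.1)[d [a gs sP]] le]]] :=
  subdiff_approx_antipodal pg cg lg eta0.
apply: (@le_trans _ _ (2^-1 * `|s| ^+ 2 + 2^-1 * dual_norm phi ^+ 2 + phi s)%:E);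
  last by rewrite lee_fin.
apply: ereal_inf_lbound; exists (x + s, phi \+ xs) => /=.
  apply/subdiffP => //; split; first exact: dual_spaceD.
  exists (a + xs s) => [|y b fb].
    by move: gs; rewrite /g; case: (f _) => [c [<-]||]//; rewrite subrK.
  have := sP (y - x) (b - xs (y - x)).
  rewrite /g [x + _]addrC subrK leeBlDr// -EFinD subrK => /(_ fb).
  have e : y - (x + s) = y - x - s by rewrite opprD addrA.
  by rewrite /= e (linear_formB (y - x) s dxs.1); lra.
have -> : x + s - x = s by rewrite addrC addrA addNr add0r.
have -> : (phi \+ xs) \- xs = phi by apply/funext => v /=; rewrite addrK.
by congr _%:E; ring.
Qed.
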